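(* Let $0<p\le q\le r<1$ with $p+r<1$, let $\delta>0$, put $C_1=(L_1+L_2)^2/\mu$ and $C_2=1/(8C_1)$, and for $k\ge 0$ let $$\lambda_k=(k+1)^{-p},\quad \eta_k=C_1(k+1)^q,\quad \theta_k=C_2(k+1)^{-r},\quad N_k=\lceil (k+1)^{1+\delta}\rceil .$$ Let $\{x_k\}_{k\ge 0}$ be the sequence generated by the RVC-IPG iteration (defined in the context) with these parameters, and suppose that the problem assumptions and the stochastic error assumption (with constant $\nu$) stated in the context hold. Let $M>0$ be the constant described in the context. Then there exist constants $C,D>0$, independent of $T$, such that for every integer $T\ge1$, $$\begin{aligned} \min_{0\le k\le T-1}\mathbb{E}\big[\|H(x_k,\eta_k)\|^2\big]\le \frac1T\Big[&(8pC_1M)^2\sum_{k=0}^{T-1}(k+1)^{-2+r+q}\Big(\tfrac{16C_1(k+1)^{p+r}}{\mu}+\tfrac{(k+1)^{q-r}}{4}+3\Big)\\ &+8C_1\nu^2\sum_{k=0}^{T-1}(k+1)^{r+q-1-\delta}\Big(10C_2(k+1)^{-2r}+\tfrac{4(k+1)^{-r+p}}{\mu}\Big)\\ &+\sum_{k=0}^{T-1}8(k+1)^{-2p}C+64C_1^2D^2T^{q+r}\Big]. \end{aligned}$$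
   Context: Setting. $X\subseteq\mathbb{R}^n$ is a nonempty closed convex set, $\|\cdot\|$ is the Euclidean norm, and $\mathbf{P}_X$ is the Euclidean projection onto $X$. $\xi:\Omega\to\mathbb{R}^d$ is a random vector on a probability space $(\Omega,\mathcal{F},\mathbb{P})$, $G:\mathbb{R}^n\times\mathbb{R}^d\to\mathbb{R}^n$ is measurable, and $F(x)=\mathbb{E}[G(x,\xi)]$ is well defined for every $x\in\mathbb{R}^n$. The stochastic inverse variational inequality (SIVI) is to find $x$ with $F(x)\in X$ and $\langle y-F(x),x\rangle\ge 0$ for all $y\in X$; its solution set is $$S=\{x\in\mathbb{R}^n:\ F(x)\in X,\ \langle y-F(x),x\rangle\ge 0\ \ \forall y\in X\}.$$ Problem assumptions. (i) $F:\mathbb{R}^n\to\mathbb{R}^n$ is monotone ($\langle F(x)-F(y),x-y\rangle\ge0$ for all $x,y$) and $L_1$-Lipschitz continuous; (ii) $\Phi:\mathbb{R}^n\to\mathbb{R}^n$ is $\mu$-strongly monotone ($\langle \Phi(x)-\Phi(y),x-y\rangle\ge\mu\|x-y\|^2$ for all $x,y$, with $\mu>0$) and $L_2$-Lipschitz continuous; (iii) $S\neq\emptyset$. Regularization. For $\lambda>0$, $F_\lambda=F+\lambda\Phi$, and $x_\lambda$ denotes the unique point with $F_\lambda(x_\lambda)\in X$ and $\langle y-F_\lambda(x_\lambda),x_\lambda\rangle\ge 0$ for all $y\in X$ (existence and uniqueness hold because $F_\lambda$ is strongly monotone and Lipschitz). $M>0$ denotes a constant such that $\|x_{\lambda_k}-x_{\lambda_l}\|\le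 M\,|\lambda_k-\lambda_l|/\lambda_l$ for all $k,l\ge 0$; such a constant exists under the problem assumptions. Residual map. For $\eta>0$, $H(x,\eta)=F(x)-\mathbf{P}_X(F(x)-\eta x)$. RVC-IPG iteration. Given $x_0\in\mathbb{R}^n$, positive parameters $\eta_k,\theta_k,\lambda_k$, positive integers $N_k$, and random samples $\xi_{j,k}$ of $\xi$ ($1\le j\le N_k$, $k\ge0$), set $\hat F_k=\frac1{N_k}\sum_{j=1}^{N_k}G(x_k,\xi_{j,k})+\lambda_k\Phi(x_k)$ and $$z_k=\mathbf{P}_X[\hat F_k-\eta_kx_k],\qquad x_{k+1}=x_k-\theta_k(\hat F_k-z_k),\qquad k\ge 0.$$ Stochastic error assumption. Let $\mathcal{F}_k=\sigma\{x_0,\xi_{j,s}:0\le s\le k-1,\ 1\le j\le N_s\}$ and $\bar w_{k,N_k}=\frac1{N_k}\sum_{j=1}^{N_k}(G(x_k,\xi_{j,k})-F(x_k))$. There exists $\nu>0$ such that for all $k$, almost surely, $\mathbb{E}[\bar w_{k,N_k}\mid\mathcal{F}_k]=0$ and $\mathbb{E}[\|\bar w_{k,N_k}\|^2\mid\mathcal{F}_k]\le \nu^2/N_k$. *)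

(* Defs.v *)
From HB Require Import structures.
From mathcomp Require Import all_boot all_order all_algebra.
From mathcomp Require Import all_classical all_reals all_analysis.

Set Implicit Arguments.
Unset Strict Implicit.
Unset Printing Implicit Defensive.

Import Order.TTheory GRing.Theory Num.Theory.
Import numFieldNormedType.Exports.

Local Open Scope classical_set_scope.
Local Open Scope ring_scope.

(* The library norm on ['rV[R]_n] is the sup norm; its topology (used for
   [closed], [open]) is the usual one, but all norms below are Euclidean. *)
Definition dot (R : realType) (n : nat) (u v : 'rV[R]_n) : R :=
  \sum_(i < n) u 0 i * v 0 i.

Definition enorm (R : realType) (n : nat) (u : 'rV[R]_n) : R :=
  Num.sqrt (dot u u).

(* R^n with its Borel sigma-algebra; the carrier is ['rV[R]_n]. *)
Definition borelV (R : realType) (n : nat) :=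
  g_sigma_algebraType (@open 'rV[R]_n).

Definition monotone_map (R : realType) (n : nat) (F : 'rV[R]_n -> 'rV[R]_n) :=
  forall x y, 0 <= dot (F x - F y) (x - y).

Definition strongly_monotone_map (R : realType) (n : nat) (mu : R)
    (F : 'rV[R]_n -> 'rV[R]_n) :=
  forall x y, mu * enorm (x - y) ^+ 2 <= dot (F x - F y) (x - y).

Definition elipschitz (R : realType) (n : nat) (L : R)
    (F : 'rV[R]_n -> 'rV[R]_n) :=
  forall x y, enorm (F x - F y) <= L * enorm (x - y).

(* The nearest point of [X]: it exists and is unique when [X] is nonempty,
   closed and convex; the default value 0 is irrelevant in that case. *)
Definition proj (R : realType) (n : nat) (X : set 'rV[R]_n) (u : 'rV[R]_n) :
    'rV[R]_n :=
  xget 0 [set z | X z /\ forall y, X y -> enorm (u - z) <= enorm (u - y)].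

Definition inverse_vi_sol (R : realType) (n : nat) (X : set 'rV[R]_n)
    (F : 'rV[R]_n -> 'rV[R]_n) : set 'rV[R]_n :=
  [set x | X (F x) /\ forall y, X y -> 0 <= dot (y - F x) x].

Definition regularized (R : realType) (n : nat) (F Phi : 'rV[R]_n -> 'rV[R]_n)
    (lam : R) : 'rV[R]_n -> 'rV[R]_n :=
  fun x => F x + lam *: Phi x.

(* The solution x_lambda of the regularized problem: it exists and is unique
   for [lam > 0] when [F] is monotone Lipschitz and [Phi] strongly monotone
   Lipschitz; the default value 0 is irrelevant in that case. *)
Definition regularized_sol (R : realType) (n : nat) (X : set 'rV[R]_n)
    (F Phi : 'rV[R]_n -> 'rV[R]_n) (lam : R) : 'rV[R]_n :=
  xget 0 (inverse_vi_sol X (regularized F Phi lam)).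

Definition residual (R : realType) (n : nat) (X : set 'rV[R]_n)
    (F : 'rV[R]_n -> 'rV[R]_n) (x : 'rV[R]_n) (eta : R) : 'rV[R]_n :=
  F x - proj X (F x - eta *: x).

Definition random_vector (R : realType) (m : nat) (disp : measure_display)
    (Omega : measurableType disp) (xi : Omega -> 'rV[R]_m) :=
  measurable_fun setT (xi : Omega -> borelV R m).

Definition same_law (R : realType) (m : nat) (disp : measure_display)
    (Omega : measurableType disp) (P : probability Omega R)
    (xi zeta : Omega -> 'rV[R]_m) :=
  forall B : set (borelV R m), measurable B -> P (xi @^-1` B) = P (zeta @^-1` B).

Definition jointly_measurable (R : realType) (n m : nat)
    (G : 'rV[R]_n -> 'rV[R]_m -> 'rV[R]_n) :=
  measurable_fun setT
    ((fun z => G z.1 z.2) : (borelV R n * borelV R m)%type -> borelV R n).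

Definition integrable_vector (R : realType) (n : nat) (disp : measure_display)
    (Omega : measurableType disp) (P : probability Omega R)
    (U : Omega -> 'rV[R]_n) :=
  forall i, P.-integrable setT (fun w => (U w 0 i)%:E).

Definition expectation_vector (R : realType) (n : nat) (disp : measure_display)
    (Omega : measurableType disp) (P : probability Omega R)
    (U : Omega -> 'rV[R]_n) : 'rV[R]_n :=
  \row_i fine 'E_P[fun w => U w 0 i].

(* [Y] is a version of E[U | A] for the sub-sigma-algebra [A]. *)
Definition is_cond_expectation (R : realType) (disp : measure_display)
    (Omega : measurableType disp) (P : probability Omega R)
    (A : set (set Omega)) (U Y : Omega -> R) :=
  [/\ P.-integrable setT (EFin \o U),
      P.-integrable setT (EFin \o Y),
      preimage_set_system setT Y measurable `<=` A &
      forall B, A B ->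
        (\int[P]_(w in B) (Y w)%:E = \int[P]_(w in B) (U w)%:E)%E].

Definition sample_mean (R : realType) (n m : nat) (Omega : Type)
    (G : 'rV[R]_n -> 'rV[R]_m -> 'rV[R]_n)
    (xis : nat -> nat -> Omega -> 'rV[R]_m) (N : nat -> nat)
    (k : nat) (x : 'rV[R]_n) (w : Omega) : 'rV[R]_n :=
  (N k)%:R^-1 *: \sum_(1 <= j < (N k).+1) G x (xis j k w).

(* [xis j k] is the sample xi_{j,k}, used for 1 <= j <= N k. *)
Fixpoint rvc_ipg (R : realType) (n m : nat) (Omega : Type) (X : set 'rV[R]_n)
    (G : 'rV[R]_n -> 'rV[R]_m -> 'rV[R]_n) (Phi : 'rV[R]_n -> 'rV[R]_n)
    (xis : nat -> nat -> Omega -> 'rV[R]_m) (lam eta theta : nat -> R)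
    (N : nat -> nat) (x0 : 'rV[R]_n) (k : nat) (w : Omega) : 'rV[R]_n :=
  if k is k'.+1 then
    let x := rvc_ipg X G Phi xis lam eta theta N x0 k' w in
    let Fhat := sample_mean G xis N k' x w + lam k' *: Phi x in
    let z := proj X (Fhat - eta k' *: x) in
    x - theta k' *: (Fhat - z)
  else x0.

(* The sigma-algebra generated by x_0 and the samples of the iterations
   before [k]; the starting point is deterministic. *)
Definition history (R : realType) (n m : nat) (Omega : Type)
    (xis : nat -> nat -> Omega -> 'rV[R]_m) (N : nat -> nat)
    (x0 : 'rV[R]_n) (k : nat) : set (set Omega) :=
  <<s [set A | (exists2 B : set (borelV R n), measurable B &
                  A = (fun=> x0) @^-1` B) \/
               (exists j s : nat, [/\ (s < k)%N, (1 <= j <= N s)%N &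
                  exists2 B : set (borelV R m), measurable B &
                    A = xis j s @^-1` B])] >>.

Definition averaged_noise (R : realType) (n m : nat) (Omega : Type)
    (F : 'rV[R]_n -> 'rV[R]_n) (G : 'rV[R]_n -> 'rV[R]_m -> 'rV[R]_n)
    (xis : nat -> nat -> Omega -> 'rV[R]_m) (N : nat -> nat)
    (x : nat -> Omega -> 'rV[R]_n) (k : nat) (w : Omega) : 'rV[R]_n :=
  (N k)%:R^-1 *:
    \sum_(1 <= j < (N k).+1) (G (x k w) (xis j k w) - F (x k w)).

(* The vector conditional expectation is taken coordinatewise. *)
Definition stochastic_error_assumption (R : realType) (n m : nat)
    (disp : measure_display) (Omega : measurableType disp)
    (P : probability Omega R)
    (F : 'rV[R]_n -> 'rV[R]_n) (G : 'rV[R]_n -> 'rV[R]_m -> 'rV[R]_n)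
    (xis : nat -> nat -> Omega -> 'rV[R]_m) (N : nat -> nat)
    (x0 : 'rV[R]_n) (x : nat -> Omega -> 'rV[R]_n) (nu : R) :=
  forall k : nat,
    (forall i : 'I_n, exists Y : Omega -> R,
       is_cond_expectation P (history xis N x0 k)
         (fun w => averaged_noise F G xis N x k w 0 i) Y /\
       {ae P, forall w, Y w = 0}) /\
    (exists Y : Omega -> R,
       is_cond_expectation P (history xis N x0 k)
         (fun w => enorm (averaged_noise F G xis N x k w) ^+ 2) Y /\
       {ae P, forall w, Y w <= nu ^+ 2 / (N k)%:R}).

(* Main.v *)
Require Import Defs.
From HB Require Import structures.
From mathcomp Require Import all_boot all_order all_algebra.
From mathcomp Require Import all_classical all_reals all_analysis.
From mathcomp Require Import measurable_realfun.
From mathcomp Require Import ring lra.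
Set Implicit Arguments.
Unset Strict Implicit.
Unset Printing Implicit Defensive.
Import Order.TTheory GRing.Theory Num.Theory.
Import numFieldNormedType.Exports.
Local Open Scope classical_set_scope.
Local Open Scope ring_scope.

(** The proof follows one trajectory at a time and takes expectations only at
the very end.

Write [A k = F + lam k Phi], [xs k] for the solution of the inverse
variational inequality of [A k], [h k] for the residual of [A k] at [x k] and
[V k = |x k - xs k|^2].  As [I - proj X] is firmly nonexpansive, a residual
map of a strongly monotone Lipschitz map is, for [eta] large enough, both
strongly monotone and cocoercive ([residual_monotone]).  Hence it has a zero,
which is the solution [xs k] ([inverse_vi_sol_exists]), and one perturbed
step contracts towards [xs k].  Passing from [xs k] to [xs k.+1] costs
[|xs k - xs k.+1|^2 / (theta k lam k)], so that ([ipg_descent])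

  [V k.+1 + theta k / (2 eta k) |h k|^2
     <= V k + beta |noise k|^2 + gamma k.+1^(p + r - 2)].

Here the exponents matter: [p <= r] makes the coefficient of the noise
bounded, [E |noise k|^2 <= nu^2 k.+1^(-1 - delta)] is summable, and so is the
drift because [p + r < 1].  Summing, [V k] and the sum of the
[theta j / (2 eta j) |h j|^2] are at most a variable [Q] whose expectation is
bounded independently of the horizon.

Since [eta k / theta k] is of order [k.+1^(q + r)], the sum of [|h k|^2] over
[k < T] is [O(T^(q + r)) Q]; this is the term with [D].  Removing the
regularization costs [lam k^2 |Phi (x k)|^2], which is
[k.+1^(-2p)] times an affine function of [V k]; this is the term with [C].
The two sums with explicit constants are nonnegative, and the minimum is at
most the average.

The expectation of the pathwise bound is taken through superadditivity of the
integral of nonnegative functions ([integral_superadditive]). *)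

(** * Euclidean inner product *)

Lemma dist_le_continuous (R : realType) (V W : normedModType R) (f : V -> W)
    (c : R) :
  (forall x y, `|f x - f y| <= c * `|x - y|) -> continuous f.
Proof.
move=> fc x; apply/cvgrPdist_le => /= e e0.
have c0 : 0 < `|c| + 1 by rewrite ltr_wpDl.
have ec : 0 < e / (`|c| + 1) by rewrite divr_gt0.
near=> y.
have xy : `|x - y| <= e / (`|c| + 1) by near: y; exact: cvgr_dist_le.
apply: le_trans (fc _ _) _.
apply: (@le_trans _ _ ((`|c| + 1) * `|x - y|)).
  by rewrite ler_wpM2r// (le_trans (ler_norm c))// lerDl.
by rewrite mulrC -ler_pdivlMr.
Unshelve. all: by end_near. Qed.

Section Dot.
Context {R : realType} {n : nat}.
Implicit Types (u v w : 'rV[R]_n).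

Lemma dotC u v : dot u v = dot v u.
Proof. by apply: eq_bigr => i _; rewrite mulrC. Qed.

Lemma dotDl u v w : dot (u + v) w = dot u w + dot v w.
Proof. by rewrite /dot -big_split; apply: eq_bigr => i _; rewrite mxE mulrDl. Qed.

Lemma dotNl u v : dot (- u) v = - dot u v.
Proof. by rewrite /dot -sumrN; apply: eq_bigr => i _; rewrite mxE mulNr. Qed.

Lemma dotZl a u v : dot (a *: u) v = a * dot u v.
Proof. by rewrite /dot mulr_sumr; apply: eq_bigr => i _; rewrite mxE mulrA. Qed.

Lemma dotDr u v w : dot u (v + w) = dot u v + dot u w.
Proof. by rewrite dotC dotDl !(dotC u). Qed.

Lemma dotNr u v : dot u (- v) = - dot u v.
Proof. by rewrite dotC dotNl dotC. Qed.

Lemma dotZr a u v : dot u (a *: v) = a * dot u v.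
Proof. by rewrite dotC dotZl dotC. Qed.

Definition dotE := (dotDl, dotDr, dotNl, dotNr, dotZl, dotZr).

Lemma dot_ge0 u : 0 <= dot u u.
Proof. by apply: sumr_ge0 => i _; exact: sqr_ge0. Qed.

Lemma enorm_ge0 u : 0 <= enorm u.
Proof. exact: sqrtr_ge0. Qed.

Lemma sqr_enorm u : enorm u ^+ 2 = dot u u.
Proof. exact: sqr_sqrtr (dot_ge0 u). Qed.

Lemma ler_enorm u v : (enorm u <= enorm v) = (dot u u <= dot v v).
Proof. by rewrite /enorm ler_sqrt ?dot_ge0. Qed.

Lemma dot_eq0 u : dot u u <= 0 -> u = 0.
Proof.
move=> u0; apply/rowP => i; rewrite mxE; apply/eqP.
rewrite -sqrf_eq0 eq_le sqr_ge0 andbT expr2; apply: le_trans u0.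
by rewrite /dot (bigD1 i)//= lerDl; apply: sumr_ge0 => j _; exact: sqr_ge0.
Qed.

(** Expand [0 <= |a u - v|^2]. *)
Lemma young (a : R) u v : 0 < a -> 2 * dot u v <= a * dot u u + a^-1 * dot v v.
Proof.
move=> a0; have := dot_ge0 (a *: u - v).
rewrite !dotE (dotC v u) => h.
rewrite -subr_ge0 -(pmulr_rge0 _ a0).
have -> : a * (a * dot u u + a^-1 * dot v v - 2 * dot u v) =
  a * (a * dot u u) + a * a^-1 * dot v v - 2 * (a * dot u v) by ring.
by rewrite divff ?gt_eqF// mul1r; lra.
Qed.

Lemma sqr_normD_le (a : R) u v : 0 < a ->
  dot (u + v) (u + v) <= (1 + a) * dot u u + (1 + a^-1) * dot v v.
Proof. by move=> a0; have := young u v a0; rewrite !dotE (dotC v u); lra. Qed.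

Lemma sqr_normD_le2 u v : dot (u + v) (u + v) <= 2 * dot u u + 2 * dot v v.
Proof. by have := sqr_normD_le u v (@ltr01 R); rewrite invr1; lra. Qed.

Lemma dot_distC u v : dot (u - v) (u - v) = dot (v - u) (v - u).
Proof. by rewrite !dotE (dotC v u); ring. Qed.

Lemma elipschitz_dot L (F : 'rV[R]_n -> 'rV[R]_n) x y : elipschitz L F ->
  dot (F x - F y) (F x - F y) <= L ^+ 2 * dot (x - y) (x - y).
Proof.
move=> /(_ x y); rewrite -!sqr_enorm -exprMn => h.
by apply: lerXn2r => //; rewrite nnegrE ?enorm_ge0// (le_trans _ h)// enorm_ge0.
Qed.

Lemma dot_le_mx_norm u : dot u u <= n%:R * `|u| ^+ 2.
Proof.
rewrite /dot; apply: le_trans (_ : \sum_(i < n) `|u| ^+ 2 <= _); last first.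
  by rewrite sumr_const card_ord mulr_natl.
apply: ler_sum => i _; rewrite -expr2 -[leLHS]real_normK ?num_real//.
apply: lerXn2r; rewrite ?nnegrE//.
by rewrite [leRHS]/Num.Def.normr /= mx_normrE; apply/bigmax_geP; right; exists (ord0, i).
Qed.

Lemma mx_norm_le_dot u : `|u| ^+ 2 <= dot u u.
Proof.
have [->|u0] := eqVneq `|u| 0; first by rewrite expr0n/= dot_ge0.
have [[i j] uij] := mx_norm_neq0 u0.
rewrite (uij : `|u| = _).
rewrite real_normK ?num_real//= [i]ord1 /dot (bigD1 j)//= expr2 lerDl.
by apply: sumr_ge0 => k _; exact: sqr_ge0.
Qed.

(** Bounded closed sets are compact, so a continuous function with a bounded
sublevel set attains its minimum on a closed set.  Used for the projection
and for zeros of strongly monotone maps. *)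
Lemma coercive_min (A : set 'rV[R]_n) (f : 'rV[R]_n -> R) (a : 'rV[R]_n) (K : R) :
  closed A -> continuous f -> A a ->
  (forall x, f x <= f a -> dot x x <= K) ->
  exists2 z, A z & forall y, A y -> f z <= f y.
Proof.
move=> Acl fc Aa fK.
pose B := A `&` [set x | f x <= f a].
have Bcl : closed B.
  apply: closedI => //.
  by apply: (@closed_comp _ _ f [set y | y <= f a]) => // x _; exact: fc.
have Bb : bounded_set B.
  exists (1 + K); split; first exact: num_real.
  move=> M KM x [_ /fK xK].
  have K0 : 0 <= K by apply: le_trans xK; exact: dot_ge0.
  have := mx_norm_le_dot x.
  have [//|xM] := leP `|x| M.
  by nra.
have B0 : B !=set0 by exists a; split => /=.
have Bf : {within B, continuous f} by apply: continuous_subspaceT.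
have [z zB zmin] := compact_EVT_min B0 (bounded_closed_compact Bb Bcl) Bf.
move: zB; rewrite inE => -[Az fza]; exists z => // y Ay.
have [ya|/ltW ya] := leP (f y) (f a); last exact: le_trans fza ya.
by apply: zmin; rewrite inE.
Qed.

(** The Lipschitz condition is Euclidean while the topology comes from the sup
norm; the two squared norms differ by a factor at most [n]. *)
Lemma continuous_sqr_norm_lipschitz (h : 'rV[R]_n -> 'rV[R]_n) (K : R) :
  (forall x y, dot (h x - h y) (h x - h y) <= K * dot (x - y) (x - y)) ->
  continuous (fun x => dot (h x) (h x)).
Proof.
move=> hK.
have hc : continuous h.
  apply: (@dist_le_continuous _ _ _ _ (Num.sqrt (`|K| * n%:R))) => x y.
  rewrite -(@ler_pXn2r _ 2)// ?nnegrE ?mulr_ge0 ?sqrtr_ge0//.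
  rewrite exprMn sqr_sqrtr ?mulr_ge0// -mulrA.
  apply: le_trans (mx_norm_le_dot _) _; apply: le_trans (hK _ _) _.
  apply: (@le_trans _ _ (`|K| * dot (x - y) (x - y))).
    by rewrite ler_wpM2r ?dot_ge0 ?ler_norm.
  by rewrite ler_wpM2l ?dot_le_mx_norm.
apply: continuous_big => [|i _ y]; first exact: add_continuous.
have hi : {for y, continuous (fun x => h x 0 i)}.
  apply: (@continuous_comp _ _ _ h (fun v : 'rV[R]_n => v 0 i)); first exact: hc.
  exact: coord_continuous.
exact: (continuousM hi hi).
Qed.
End Dot.

Section Norm.
Context {R : realType} {n : nat}.
Implicit Types (u v w : 'rV[R]_n).

Lemma cauchy_schwarz u v : dot u v <= enorm u * enorm v.
Proof.
have [v0|v0] := eqVneq (dot v v) 0.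
  by rewrite (@dot_eq0 _ _ v) ?v0// /enorm -(scale0r v) !dotE !mul0r sqrtr0 mulr0.
have vv : 0 < dot v v by rewrite lt_neqAle eq_sym v0 dot_ge0.
rewrite /enorm -sqrtrM ?dot_ge0//; apply: le_trans (ler_norm _) _.
rewrite -sqrtr_sqr; apply: ler_wsqrtr.
have := dot_ge0 (dot v v *: u - dot u v *: v).
rewrite !dotE (dotC v u) => h; rewrite -(ler_pM2l vv); lra.
Qed.

Lemma ler_enormD u v : enorm (u + v) <= enorm u + enorm v.
Proof.
rewrite -(@ler_pXn2r _ 2)// ?nnegrE ?addr_ge0 ?enorm_ge0//.
have := cauchy_schwarz u v.
by rewrite sqr_enorm sqrrD !sqr_enorm !dotE (dotC v u); lra.
Qed.

Lemma enormZ (a : R) u : 0 <= a -> enorm (a *: u) = a * enorm u.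
Proof.
move=> a0; rewrite /enorm !dotE mulrA -expr2 sqrtrM ?sqr_ge0//.
by rewrite sqrtr_sqr ger0_norm.
Qed.

(** The constant is uniform in [lam], which makes [C1] a valid choice for all
regularized maps at once. *)
Lemma regularized_lipschitz (F Phi : 'rV[R]_n -> 'rV[R]_n) L1 L2 lam :
  0 <= lam <= 1 -> elipschitz L1 F -> elipschitz L2 Phi ->
  elipschitz (L1 + L2) (regularized F Phi lam).
Proof.
move=> /andP[lam0 lam1] FL PL x y.
have -> : regularized F Phi lam x - regularized F Phi lam y =
    (F x - F y) + lam *: (Phi x - Phi y).
  by rewrite /regularized; apply/rowP => i; rewrite !mxE; ring.
apply: le_trans (ler_enormD _ _) _; rewrite mulrDl; apply: lerD => //.
rewrite enormZ//; apply: le_trans (PL x y).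
by rewrite ler_piMl// enorm_ge0.
Qed.

Lemma regularized_monotone (F Phi : 'rV[R]_n -> 'rV[R]_n) mu lam x y :
  0 <= lam -> monotone_map F -> strongly_monotone_map mu Phi ->
  lam * mu * dot (x - y) (x - y) <=
  dot (regularized F Phi lam x - regularized F Phi lam y) (x - y).
Proof.
move=> lam0 Fm /(_ x y); rewrite sqr_enorm => Pm.
have -> : regularized F Phi lam x - regularized F Phi lam y =
    (F x - F y) + lam *: (Phi x - Phi y).
  by rewrite /regularized; apply/rowP => i; rewrite !mxE; ring.
rewrite dotDl dotZl -mulrA -[leLHS]add0r; apply: lerD; first exact: Fm.
by rewrite ler_wpM2l.
Qed.

(** Forces [0 < L1 + L2] as soon as the space has a nonzero vector; the
degenerate case [C1 = 0] is thereby the zero-dimensional one. *)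
Lemma strong_monotone_le_lipschitz (F Phi : 'rV[R]_n -> 'rV[R]_n) mu L1 L2 u :
  elipschitz L1 F -> strongly_monotone_map mu Phi -> elipschitz L2 Phi ->
  mu * dot u u <= (L1 + L2) * dot u u.
Proof.
move=> FL Pm PL.
have := Pm u 0; rewrite subr0 sqr_enorm => /le_trans; apply.
apply: le_trans (cauchy_schwarz _ _) _.
have := PL u 0; have := FL u 0; rewrite !subr0 => /(le_trans (enorm_ge0 _)) l1 l2.
have u0 := enorm_ge0 u.
rewrite -sqr_enorm; have := ler_wpM2r u0 l2; have := mulr_ge0 l1 u0; lra.
Qed.

End Norm.

(** * Euclidean projection and the residual map *)

Lemma convex_segment (R : realType) (n : nat) (X : set 'rV[R]_n) a b (t : R) :
  convex_set (X : set (convex_lmodType 'rV[R]_n)) -> X a -> X b ->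
  0 <= t <= 1 -> X (a + t *: (b - a)).
Proof.
move=> Xc Xa Xb t01.
have t01' : Itv.spec (@Itv.num_sem R) (Itv.Real `[0%Z, 1%Z]) t.
  by rewrite /= /Itv.num_sem in_itv/= num_real.
have := Xc b a (Itv.mk t01') (mem_set Xb) (mem_set Xa).
rewrite inE; congr X; rewrite /conv/= scalerBr scalerBl scale1r.
exact: addrCA.
Qed.

Section Proj.
Context {R : realType} {n : nat} (X : set 'rV[R]_n).
Context (X0 : X !=set0) (Xcl : closed X)
  (Xc : convex_set (X : set (convex_lmodType 'rV[R]_n))).
Local Notation P := (Defs.proj X).

Lemma projP u : X (P u) /\ forall y, X y -> enorm (u - P u) <= enorm (u - y).
Proof.
rewrite /Defs.proj; case: xgetP => [z -> //|none]; exfalso.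
have [a Xa] := X0.
pose f (y : 'rV[R]_n) := dot (y - u) (y - u).
have fc : continuous f.
  apply: (@continuous_sqr_norm_lipschitz _ _ (fun y => y - u) 1) => x y.
  by rewrite mul1r opprB addrA subrK.
have [x fx|z Xz zmin] := @coercive_min _ _ X f a (2 * f a + 2 * dot u u) Xcl fc Xa.
  have := sqr_normD_le2 (x - u) u; rewrite subrK -/(f x) => /le_trans; apply.
  by rewrite lerD2r ler_wpM2l.
apply: (none z); split => // y Xy; rewrite ler_enorm.
by rewrite dot_distC (dot_distC u); exact: zmin.
Qed.

Lemma proj_in u : X (P u). Proof. by have [] := projP u. Qed.

(** First-order optimality: moving from the projection towards [y] by a small
step [t] would otherwise decrease the distance to [u]. *)
Lemma proj_obtuse u y : X y -> dot (u - P u) (y - P u) <= 0.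
Proof.
move=> Xy; have [Xz zmin] := projP u.
set z := P u in Xz zmin *.
set b := dot _ _; rewrite leNgt; apply/negP => b0.
pose c := dot (y - z) (y - z).
have c0 : 0 <= c by exact: dot_ge0.
(* Any positive t < 2 b / c works; this one is also at most 1. *)
pose t := b / (b + c).
have bc : 0 < b + c by rewrite ltr_pwDl.
have t0 : 0 < t by rewrite divr_gt0.
have t1 : t <= 1 by rewrite ler_pdivrMr// mul1r lerDl.
have := zmin _ (convex_segment Xc Xz Xy (introT andP (conj (ltW t0) t1))).
rewrite ler_enorm opprD addrA.
rewrite [leRHS](_ : _ = dot (u - z) (u - z) - 2 * t * b + t ^+ 2 * c); last first.
  rewrite /b /c; set p := u - z; set q := y - z.
  by clearbody p q; rewrite !dotE (dotC q p); ring.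
have tb : t * (b + c) = b by rewrite divfK// gt_eqF.
nra.
Qed.

Lemma proj_unique u z : X z -> (forall y, X y -> dot (u - z) (y - z) <= 0) ->
  P u = z.
Proof.
move=> Xz h; apply/eqP; rewrite -subr_eq0; apply/eqP; apply: dot_eq0.
have := h _ (proj_in u); have := proj_obtuse u Xz; move: (P u) => w.
by rewrite !dotE ?(dotC z u) ?(dotC w u) ?(dotC w z); lra.
Qed.

Lemma proj_firm u v : 0 <= dot ((u - P u) - (v - P v)) (P u - P v).
Proof.
have := proj_obtuse u (proj_in v); have := proj_obtuse v (proj_in u).
by move: (P u) (P v) => a b; rewrite !dotE; lra.
Qed.

(** With [a] the difference of the complements and [b] that of the
projections, [u - v = a + b] and [0 <= dot a b], so [|a|^2 <= |u - v|^2]. *)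
Lemma proj_compl_nonexpansive u v :
  dot ((u - P u) - (v - P v)) ((u - P u) - (v - P v)) <= dot (u - v) (u - v).
Proof.
have := proj_firm u v; have := dot_ge0 (P u - P v).
set a := _ - (v - _); set b := P u - P v => b0 ab.
have -> : u - v = a + b.
  by rewrite /a /b; apply/rowP => i; rewrite !mxE; ring.
clearbody a b.
by rewrite (_ : dot (a + b) _ = dot a a + 2 * dot a b + dot b b);
  [lra | rewrite !dotE (dotC b a); ring].
Qed.

Lemma residual_compl F x y eta : residual X F x eta - residual X F y eta =
  (F x - eta *: x - P (F x - eta *: x)) - (F y - eta *: y - P (F y - eta *: y))
  + eta *: (x - y).
Proof.
rewrite /residual scalerBr; apply/rowP => i; rewrite !mxE; ring.
Qed.

(** Write [d = x - y], [u = F x - F y] and [h] for the difference of the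
residuals.  Firm nonexpansiveness of the projection reads
[dot (h - eta d) (h - u) <= 0], that is
[|h|^2 + eta dot u d <= dot h u + eta dot h d]; bound [dot h u] by
[(|h|^2 + |u|^2) / 2] and let strong monotonicity pay for [|u|^2]. *)
Lemma residual_monotone F x y eta sigma ell : 0 < eta ->
  dot (F x - F y) (F x - F y) <= ell * dot (x - y) (x - y) ->
  sigma * dot (x - y) (x - y) <= dot (F x - F y) (x - y) ->
  ell <= eta * sigma ->
  dot (residual X F x eta - residual X F y eta)
      (residual X F x eta - residual X F y eta)
    + eta * sigma * dot (x - y) (x - y)
  <= 2 * eta * dot (residual X F x eta - residual X F y eta) (x - y).
Proof.
move=> eta0 FL Fs ls; set h := residual X F x eta - residual X F y eta.
have := proj_firm (F x - eta *: x) (F y - eta *: y).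
have hE := residual_compl F x y eta; rewrite -/h in hE.
set c := (X in dot X _).
have -> : c = h - eta *: (x - y) by rewrite hE addrK.
have -> : P (F x - eta *: x) - P (F y - eta *: y) = F x - F y - h.
  by rewrite /h /residual; apply/rowP => i; rewrite !mxE; ring.
clearbody h => {hE c}.
move: (x - y) (F x - F y) FL Fs => d u FL Fs firm.
have hu := dot_ge0 (h - u).
have dd := dot_ge0 d.
have e1 : eta * sigma * dot d d <= eta * dot u d by rewrite -mulrA ler_pM2l.
have e2 : ell * dot d d <= eta * sigma * dot d d by rewrite ler_wpM2r.
move: firm hu; rewrite !dotE (dotC u h) (dotC d u) (dotC d h); nra.
Qed.

End Proj.

(** * Zeros of strongly monotone maps *)

Section Zero.
Context {R : realType} {n : nat}.

(** Strong monotonicity makes [|h|^2] coercive, hence it has a minimizer [z].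
A gradient-like step [z - t h z] would decrease [|h|^2] unless [h z = 0]. *)
Lemma strongly_monotone_zero (h : 'rV[R]_n -> 'rV[R]_n) (c K : R) : 0 < c ->
  (forall x y, c * dot (x - y) (x - y) <= dot (h x - h y) (x - y)) ->
  (forall x y, dot (h x - h y) (h x - h y) <= K * dot (x - y) (x - y)) ->
  exists z, h z = 0.
Proof.
move=> c0 hc hK.
have fc := continuous_sqr_norm_lipschitz hK.
have [x fx|z _ zmin] := @coercive_min _ _ setT _ 0 (4 * dot (h 0) (h 0) / c ^+ 2) closedT fc I.
  have := hc x 0; rewrite subr0 => h1.
  have h2 : dot (h x - h 0) (h x - h 0) <= 4 * dot (h 0) (h 0).
    by have := sqr_normD_le2 (h x) (- h 0); rewrite dotNl dotNr opprK; lra.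
  have := young (h x - h 0) x (_ : 0 < c^-1); rewrite invr_gt0 invrK => /(_ c0) h3.
  have h4 : c * dot x x <= c^-1 * (4 * dot (h 0) (h 0)).
    have : c^-1 * dot (h x - h 0) (h x - h 0) <= c^-1 * (4 * dot (h 0) (h 0)).
      by rewrite ler_pM2l// invr_gt0.
    lra.
  rewrite ler_pdivlMr ?exprn_gt0//.
  by rewrite mulrC expr2 -mulrA -ler_pdivlMl.
exists z; apply: dot_eq0.
pose K' := `|K| + 1.
have K0 : 0 < K' by rewrite ltr_wpDl.
(* The step size minimizes 1 - 2 c t + K' t^2, up to replacing K by K' > 0. *)
pose t := c / K'.
have t0 : 0 < t by rewrite divr_gt0.
pose y := z - t *: h z.
have zy : z - y = t *: h z by rewrite /y opprB addrC subrK.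
clearbody y.
have := zmin y I.
have := hc z y; have := hK z y; rewrite zy !dotZl !dotZr.
have : dot (h y) (h y) = dot (h z) (h z) - 2 * dot (h z - h y) (h z) + dot (h z - h y) (h z - h y).
  by rewrite !dotE (dotC (h y) (h z)); ring.
move: (h z - h y) => g -> hKz hcz hmin.
have tK : t * K' = c by rewrite divfK// gt_eqF.
have z0 := dot_ge0 (h z).
have K1 : K * (t * (t * dot (h z) (h z))) <= K' * (t * (t * dot (h z) (h z))).
  have t0' := ltW t0; apply: ler_wpM2r. by apply: mulr_ge0 => //; apply: mulr_ge0.
  by rewrite /K' (le_trans (ler_norm K))// lerDl.
have K2 : K' * (t * (t * dot (h z) (h z))) = c * t * dot (h z) (h z).
  by rewrite -tK; ring.
have hcz' : c * (t * dot (h z) (h z)) <= dot g (h z).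
  by rewrite -(ler_pM2l t0); lra.
have ct : 0 < c * t by rewrite mulr_gt0.
have : c * t * dot (h z) (h z) <= 0 by lra.
by rewrite pmulr_rle0.
Qed.

End Zero.

(** * The inverse variational inequality and one step of the iteration *)

Section Step.
Context {R : realType} {n : nat} (X : set 'rV[R]_n).
Context (X0 : X !=set0) (Xcl : closed X)
  (Xc : convex_set (X : set (convex_lmodType 'rV[R]_n))).
Local Notation P := (Defs.proj X).

(** The variational inequality at [x] says that [F x] satisfies the obtuse
angle characterization of the projection of [F x - eta x]. *)
Lemma inverse_vi_sol_residual F x eta : 0 < eta ->
  inverse_vi_sol X F x <-> residual X F x eta = 0.
Proof.
move=> eta0; split=> [[XFx h]|].
  rewrite /residual (proj_unique X0 Xcl Xc XFx) ?subrr// => y /h hy.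
  by rewrite addrAC subrr add0r dotNl dotZl dotC oppr_le0 mulr_ge0// ltW.
move/eqP; rewrite subr_eq0 => /eqP FP; split.
  by rewrite FP; exact: proj_in.
move=> y Xy; have := proj_obtuse X0 Xcl Xc (F x - eta *: x) Xy.
by rewrite -FP addrAC subrr add0r dotNl dotZl dotC oppr_le0 pmulr_rge0.
Qed.

(** For [eta] large the residual map is strongly monotone with constant
[sigma / 2] and Lipschitz, and the solutions are its zeros. *)
Lemma inverse_vi_sol_exists (F : 'rV[R]_n -> 'rV[R]_n) (sigma ell : R) : 0 < sigma ->
  (forall x y, dot (F x - F y) (F x - F y) <= ell * dot (x - y) (x - y)) ->
  (forall x y, sigma * dot (x - y) (x - y) <= dot (F x - F y) (x - y)) ->
  inverse_vi_sol X F !=set0.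
Proof.
move=> s0 FL Fs.
pose eta := (`|ell| + 1) / sigma.
have eta0 : 0 < eta by rewrite divr_gt0// ltr_wpDl.
have es : ell <= eta * sigma.
  by rewrite divfK ?gt_eqF// (le_trans (ler_norm ell))// lerDl.
have mono x y := residual_monotone X0 Xcl Xc eta0 (FL x y) (Fs x y) es.
have [|||z hz] := @strongly_monotone_zero _ _
  (fun x => residual X F x eta) (sigma / 2) (4 * eta ^+ 2).
- exact: divr_gt0.
- move=> x y; have := mono x y; set h := residual _ _ _ _ - _ => hm.
  have eta2 : 0 < 2 * eta by rewrite mulr_gt0.
  rewrite -(ler_pM2l eta2); have := dot_ge0 h; lra.
- move=> x y; have := mono x y; set h := residual _ _ _ _ - _ => hm.
  have := young h (eta *: (x - y)) (_ : 0 < 2^-1).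
  rewrite invr_gt0 invrK !dotZr dotZl => /(_ (ltr0Sn _ _)).
  have : 0 <= eta * sigma * dot (x - y) (x - y).
    exact: mulr_ge0 (mulr_ge0 (ltW eta0) (ltW s0)) (dot_ge0 _).
  lra.
by exists z; apply/(inverse_vi_sol_residual F z eta0).
Qed.

(** The two residuals differ by a difference of values of [I - proj X] at
points at distance [lam |Phi x|]. *)
Lemma residual_regularized (F Phi : 'rV[R]_n -> 'rV[R]_n) lam x eta :
  dot (residual X F x eta) (residual X F x eta) <=
  2 * dot (residual X (regularized F Phi lam) x eta)
          (residual X (regularized F Phi lam) x eta)
  + 2 * (lam ^+ 2 * dot (Phi x) (Phi x)).
Proof.
set h := residual X (regularized _ _ _) x eta.
have -> : residual X F x eta = h + (residual X F x eta - h).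
  by rewrite addrC subrK.
apply: le_trans (sqr_normD_le2 _ _) _; rewrite lerD2l ler_pM2l//.
have -> : residual X F x eta - h =
   (F x - eta *: x - P (F x - eta *: x)) -
   (regularized F Phi lam x - eta *: x - P (regularized F Phi lam x - eta *: x)).
  by rewrite /h /residual; apply/rowP => i; rewrite !mxE; ring.
apply: le_trans (proj_compl_nonexpansive X0 Xcl Xc _ _) _.
have -> : F x - eta *: x - (regularized F Phi lam x - eta *: x) = - (lam *: Phi x).
  by rewrite /regularized; apply/rowP => i; rewrite !mxE; ring.
by rewrite dotNl dotNr opprK dotZl dotZr mulrA.
Qed.

(** The perturbed direction is [h + g] with [|g| <= |w|], again because
[I - proj X] is nonexpansive.  The cross term with [g] is absorbed by half of
the strong monotonicity, and [2 theta^2 |h|^2] by half of the cocoercivity,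
which is where [theta * eta <= 1 / 4] enters. *)
Lemma ipg_step (A : 'rV[R]_n -> 'rV[R]_n) (sigma ell theta eta : R) x xs w :
  (forall x y, dot (A x - A y) (A x - A y) <= ell * dot (x - y) (x - y)) ->
  (forall x y, sigma * dot (x - y) (x - y) <= dot (A x - A y) (x - y)) ->
  0 < sigma -> 0 < theta -> 0 < eta -> ell <= eta * sigma ->
  theta * eta <= 4^-1 -> inverse_vi_sol X A xs ->
  let x' := x - theta *: (A x + w - P (A x + w - eta *: x)) in
  let h := residual X A x eta in
  (dot (x' - xs) (x' - xs) <= (1 - theta * sigma / 2) * dot (x - xs) (x - xs)
    - theta / (2 * eta) * dot h h
    + (2 * theta ^+ 2 + 2 * theta / sigma) * dot w w) : Prop.
Proof.
move=> AL As s0 t0 eta0 es te /(inverse_vi_sol_residual _ _ eta0) hxs x' h.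
have := residual_monotone X0 Xcl Xc eta0 (AL x xs) (As x xs) es.
rewrite hxs subr0 -/h => mono.
set g := (A x + w - P (A x + w - eta *: x)) - h.
have gw : dot g g <= dot w w.
  have -> : g = (A x + w - eta *: x - P (A x + w - eta *: x))
     - (A x - eta *: x - P (A x - eta *: x)).
    by rewrite /g /h /residual; apply/rowP => i; rewrite !mxE; ring.
  apply: le_trans (proj_compl_nonexpansive X0 Xcl Xc _ _) _.
  by rewrite (_ : A x + w - eta *: x - (A x - eta *: x) = w)//;
    apply/rowP => i; rewrite !mxE; ring.
have -> : x' - xs = (x - xs) - theta *: (h + g).
  by rewrite /g [h + _]addrC subrK /x' addrAC.
clearbody h g; clear x' hxs; move: (x - xs) mono => d mono.
have hg := sqr_normD_le2 h g.
have yg := young d (- g) (_ : 0 < sigma / 2).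
have := yg (divr_gt0 s0 (ltr0Sn _ _)); rewrite invf_div !dotNr dotNl opprK => {}yg.
have -> : dot (d - theta *: (h + g)) (d - theta *: (h + g)) =
  dot d d - theta * (2 * dot h d) - theta * (2 * dot d g)
    + theta ^+ 2 * dot (h + g) (h + g).
  by rewrite !dotE (dotC h d) (dotC g d) (dotC g h); ring.
have m1 : theta * (eta^-1 * dot h h + sigma * dot d d) <= theta * (2 * dot h d).
  rewrite ler_pM2l// -(ler_pM2l eta0) mulrDr !mulrA divff ?gt_eqF// mul1r.
  by rewrite [eta * 2]mulrC.
have m2 : theta * (- (2 * dot d g)) <= theta * (sigma / 2 * dot d d + 2 / sigma * dot w w).
  rewrite ler_pM2l//.
  have : 2 / sigma * dot g g <= 2 / sigma * dot w w by rewrite ler_pM2l// divr_gt0.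
  lra.
have m3 : theta ^+ 2 * dot (h + g) (h + g) <= theta ^+ 2 * (2 * dot h h + 2 * dot w w).
  by rewrite ler_pM2l ?exprn_gt0//; lra.
have m4 : theta ^+ 2 * (2 * dot h h) <= theta / (2 * eta) * dot h h.
  rewrite expr2 mulrA ler_wpM2r ?dot_ge0// -mulrA ler_pM2l//.
  rewrite -(ler_pM2r eta0) [_^-1 * _](_ : _ = 2^-1); [lra | by field; rewrite gt_eqF].
have e1 : theta / (2 * eta) * dot h h = theta * (eta^-1 * dot h h) / 2.
  by field; rewrite gt_eqF.
have e2 : (2 * theta ^+ 2 + 2 * theta / sigma) * dot w w =
   theta ^+ 2 * (2 * dot w w) + theta * (2 / sigma * dot w w) by ring.
move: m1 m2 m3 m4; rewrite e1 e2 !mulrDr; lra.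
Qed.

(** The weight in the splitting of [|x' - xs + (xs - xs')|^2] is chosen as
the contraction gain [theta sigma / 2], so that the factor in front of
[|x - xs|^2] is at most 1. *)
Lemma ipg_descent (A : 'rV[R]_n -> 'rV[R]_n) (sigma ell theta eta : R) x xs xs' w :
  (forall x y, dot (A x - A y) (A x - A y) <= ell * dot (x - y) (x - y)) ->
  (forall x y, sigma * dot (x - y) (x - y) <= dot (A x - A y) (x - y)) ->
  0 < sigma -> 0 < theta -> 0 < eta -> ell <= eta * sigma ->
  theta * eta <= 4^-1 -> inverse_vi_sol X A xs ->
  let x' := x - theta *: (A x + w - P (A x + w - eta *: x)) in
  let h := residual X A x eta in
  (dot (x' - xs') (x' - xs') + theta / (2 * eta) * dot h h <= dot (x - xs) (x - xs)
    + (1 + theta * sigma / 2) * (2 * theta ^+ 2 + 2 * theta / sigma) * dot w w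
    + (1 + 2 / (theta * sigma)) * dot (xs - xs') (xs - xs')) : Prop.
Proof.
move=> AL As s0 t0 eta0 es te sol x' h.
have := ipg_step x w AL As s0 t0 eta0 es te sol.
rewrite /= -/x' -/h => st.
have a0 : 0 < theta * sigma / 2 by rewrite divr_gt0// mulr_gt0.
have := sqr_normD_le (x' - xs) (xs - xs') a0.
rewrite addrA subrK invf_div => sh.
apply: le_trans (lerD sh (lexx _)) _.
have : (1 + theta * sigma / 2) * dot (x' - xs) (x' - xs) <= (1 + theta * sigma / 2) *
  ((1 - theta * sigma / 2) * dot (x - xs) (x - xs)
    - theta / (2 * eta) * dot h h
    + (2 * theta ^+ 2 + 2 * theta / sigma) * dot w w).
  by apply: ler_wpM2l => //; lra.
set b := 2 * theta ^+ 2 + _; set c := theta / (2 * eta).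
have c0 : 0 < c by rewrite divr_gt0// mulr_gt0.
have := mulr_ge0 (mulr_ge0 (ltW a0) (ltW a0)) (dot_ge0 (x - xs)).
have := mulr_ge0 (mulr_ge0 (ltW a0) (ltW c0)) (dot_ge0 h).
move: (theta * sigma / 2) => a; lra.
Qed.

End Step.

(** Separates the exact value of the regularized map from the sampling error in
the recursion. *)
Lemma rvc_ipgS (R : realType) (n m : nat) (Omega : Type) (X : set 'rV[R]_n)
    (F : 'rV[R]_n -> 'rV[R]_n)
    (G : 'rV[R]_n -> 'rV[R]_m -> 'rV[R]_n) (Phi : 'rV[R]_n -> 'rV[R]_n)
    (xis : nat -> nat -> Omega -> 'rV[R]_m) (lam eta theta : nat -> R)
    (N : nat -> nat) (x0 : 'rV[R]_n) (x : nat -> Omega -> 'rV[R]_n) k w :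
  x = rvc_ipg X G Phi xis lam eta theta N x0 -> (0 < N k)%N ->
  let A := regularized F Phi (lam k) (x k w) + averaged_noise F G xis N x k w in
  x k.+1 w = x k w - theta k *: (A - Defs.proj X (A - eta k *: x k w)).
Proof.
move=> xE N0 A.
rewrite [in LHS]xE /= -xE.
suff -> : sample_mean G xis N k (x k w) w + lam k *: Phi (x k w) = A by [].
rewrite /A /regularized addrAC; congr (_ + _).
rewrite /sample_mean /averaged_noise sumrB scalerBr addrC.
rewrite sumr_const_nat subn1/= -(scaler_nat (N k) (F (x k w))) scalerA mulVf ?scale1r ?subrK//.
by rewrite pnatr_eq0 -lt0n.
Qed.

Lemma telescope_le (R : realType) (V a b : nat -> R) :
  (forall k, V k.+1 + a k <= V k + b k) ->
  forall k, V k + \sum_(0 <= j < k) a j <= V 0 + \sum_(0 <= j < k) b j.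
Proof.
move=> h; elim=> [|k IH]; first by rewrite !big_nil.
by rewrite !big_nat_recr//=; have := h k; lra.
Qed.

(** * Estimates on the parameter sequences *)

(** Discrete form of [- d/dx x^(-e) = e x^(-1-e)], from [1 + t <= exp t]
and [ln (1 + t) <= t]. *)
Lemma powR_telescope (R : realType) (e a : R) : 0 < e -> 0 < a ->
  e * (a + 1) `^ (- (1 + e)) <= a `^ (- e) - (a + 1) `^ (- e).
Proof.
move=> e0 a0; have b0 : 0 < a + 1 by rewrite addr_gt0.
have bn0 : a + 1 != 0 by rewrite gt_eqF.
have -> : (a + 1) `^ (- (1 + e)) = (a + 1) `^ (- e) / (a + 1).
  by rewrite opprD [- 1 - e]addrC powRB ?bn0 ?implybT// powRr1// ltW.
have aE : a `^ (- e) = (a + 1) `^ (- e) * (a / (a + 1)) `^ (- e).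
  by rewrite -powRM ?divr_ge0 ?ltW//; congr (_ `^ _); field.
have := @le_ln1Dx R (- (a + 1)^-1); rewrite ltrN2 invf_lt1// ltrDr => /(_ a0).
have -> : 1 - (a + 1)^-1 = a / (a + 1) by field.
move=> lnle; have := expR_ge1Dx (- e * ln (a / (a + 1))).
rewrite (_ : expR _ = (a / (a + 1)) `^ (- e)); last first.
  by rewrite /powR gt_eqF// divr_gt0.
move=> le1; rewrite aE -[in leRHS](mulr1 ((a + 1) `^ (- e))) -mulrA -mulrBr.
rewrite mulrCA; apply: ler_wpM2l; first exact: powR_ge0.
by nra.
Qed.

Lemma sum_powR_le (R : realType) (e : R) (T : nat) : 0 < e ->
  \sum_(0 <= k < T) k.+1%:R `^ (- (1 + e)) <= 1 + e^-1.
Proof.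
move=> e0; case: T => [|T].
  by rewrite big_nil addr_ge0// invr_ge0 ltW.
suff : \sum_(0 <= k < T.+1) k.+1%:R `^ (- (1 + e)) <=
    1 + (1 - T.+1%:R `^ (- e)) / e.
  move=> /le_trans; apply; rewrite lerD2l -[leRHS]mul1r.
  by rewrite ler_pM2r ?invr_gt0// lerBlDr lerDl powR_ge0.
elim: T => [|T IH].
  by rewrite big_nat1 !powR1 subrr mul0r addr0.
rewrite big_nat_recr//=; have := @powR_telescope _ e T.+1%:R e0 (ltr0Sn _ _).
rewrite natr1 => h.
have h' : T.+2%:R `^ (- (1 + e)) <= (T.+1%:R `^ (- e) - T.+2%:R `^ (- e)) / e.
  by rewrite ler_pdivlMr// mulrC.
by move: IH h'; rewrite !mulrBl; lra.
Qed.

Section StepSizes.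
Context {R : realType} (p q r C1 C2 mu : R).
Context (p0 : 0 < p) (pq : p <= q) (qr : q <= r)
  (C10 : 0 < C1) (mu0 : 0 < mu) (C2E : C2 = 1 / (8 * C1)).
Let C20 : 0 < C2. Proof. by rewrite C2E divr_gt0// mulr_gt0. Qed.

Lemma powR_le1 (a e : R) : 1 <= a -> e <= 0 -> a `^ e <= 1.
Proof. by move=> a1 e0; rewrite -(powRr0 a); exact: ler_powR. Qed.

Lemma powR_ge1 (a e : R) : 1 <= a -> 0 <= e -> 1 <= a `^ e.
Proof. by move=> a1 e0; rewrite -[leLHS](powRr0 a); exact: ler_powR. Qed.

Lemma powR_mulD (a e f : R) : 1 <= a -> a `^ e * a `^ f = a `^ (e + f).
Proof.
move=> a1; rewrite powRD// (_ : a != 0) ?implybT// gt_eqF//.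
exact: lt_le_trans ltr01 a1.
Qed.

Let r0 : 0 < r. Proof. by move: p0 pq qr; lra. Qed.
Let rp : - r - p <= 0. Proof. by move: p0 r0; lra. Qed.
Let pr : p - r <= 0. Proof. by move: pq qr; lra. Qed.

Context (a : R) (a1 : 1 <= a).
Let theta := C2 * a `^ (- r).
Let eta := C1 * a `^ q.
Let sigma := a `^ (- p) * mu.
Let a0 : 0 < a := lt_le_trans ltr01 a1.
Let theta0 : 0 < theta. Proof. by rewrite mulr_gt0 ?powR_gt0. Qed.
Let sigma0 : 0 < sigma. Proof. by rewrite mulr_gt0 ?powR_gt0. Qed.

Lemma step_eta_le : theta * eta <= 4^-1.
Proof.
have -> : theta * eta = 8^-1 * a `^ (q - r).
  rewrite /theta /eta mulrACA powR_mulD// [- r + q]addrC.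
  by congr (_ * _); rewrite C2E; field; rewrite gt_eqF.
have : a `^ (q - r) <= 1 by apply: powR_le1 => //; rewrite subr_le0.
by lra.
Qed.

(** The hypothesis of [residual_monotone] with [ell = C1 mu = (L1 + L2)^2]; it
holds for all [a >= 1] because [p <= q]. *)
Lemma eta_sigma_ge : C1 * mu <= eta * sigma.
Proof.
have -> : eta * sigma = C1 * mu * a `^ (q - p).
  by rewrite -powR_mulD// /eta /sigma; ring.
by rewrite ler_peMr ?powR_ge1 ?subr_ge0// ltW// mulr_gt0.
Qed.

Lemma step_sigma_le : theta * sigma <= C2 * mu.
Proof.
have -> : theta * sigma = C2 * mu * a `^ (- r - p).
  by rewrite -powR_mulD// /theta /sigma; ring.
by rewrite ler_piMr ?powR_le1 ?mulr_ge0 ?(ltW C20) ?(ltW mu0).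
Qed.

(** The critical summand is [theta / sigma], of order [a^(p - r)]. *)
Lemma noise_coef_le :
  (1 + theta * sigma / 2) * (2 * theta ^+ 2 + 2 * theta / sigma) <=
  (1 + C2 * mu) * (2 * C2 ^+ 2 + 2 * C2 / mu).
Proof.
have ts := mulr_gt0 theta0 sigma0.
have tC : theta <= C2 by rewrite ler_piMr ?powR_le1 ?(ltW C20)// oppr_le0 ltW.
apply: ler_pM.
- by rewrite addr_ge0// divr_ge0 ?(ltW ts).
- apply: addr_ge0; first exact: mulr_ge0 (ler0n _ _) (sqr_ge0 _).
  exact: divr_ge0 (mulr_ge0 (ler0n _ _) (ltW theta0)) (ltW sigma0).
- by have := step_sigma_le; lra.
apply: lerD.
  by rewrite ler_pM2l//; apply: lerXn2r; rewrite ?nnegrE ?(ltW theta0) ?(ltW C20).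
have -> : 2 * theta / sigma = 2 * C2 / mu * a `^ (p - r).
  rewrite /theta /sigma invfM -powRN opprK -(@powR_mulD a p) //; ring.
rewrite ler_piMr ?powR_le1//.
by rewrite divr_ge0 ?mulr_ge0 ?(ltW C20) ?(ltW mu0).
Qed.

(** Multiplied by the squared drift, of order [a^(-2)], this is summable over
[a = k.+1] because [p + r < 1]. *)
Lemma drift_coef_le :
  1 + 2 / (theta * sigma) <= (1 + 2 / (C2 * mu)) * a `^ (p + r).
Proof.
rewrite [leRHS]mulrDl [1 * _]mul1r; apply: lerD.
  exact: powR_ge1 a1 (addr_ge0 (ltW p0) (ltW r0)).
rewrite le_eqVlt; apply/orP; left; apply/eqP.
have -> : theta * sigma = C2 * mu * a `^ (- (p + r)).
  by rewrite opprD addrC -powR_mulD// /theta /sigma; ring.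
by rewrite [in LHS]invfM -powRN opprK mulrA.
Qed.

Lemma eta_div_step : 2 * eta / theta = 2 * (C1 / C2) * a `^ (q + r).
Proof. by rewrite /eta /theta invfM -powRN opprK -powR_mulD//; ring. Qed.

End StepSizes.

(** With [t = k.+1 / k.+2], the relative variation is [1 - t^p <= 1 - t]. *)
Lemma powR_drift_le (R : realType) (p : R) (k : nat) : 0 < p -> p <= 1 ->
  `|k.+2%:R `^ (- p) - k.+1%:R `^ (- p)| / k.+1%:R `^ (- p) <= k.+1%:R^-1 :> R.
Proof.
move=> p0 p1.
have k0 : (0 : R) < k.+1%:R by rewrite ltr0Sn.
have k20 : (0 : R) < k.+2%:R by rewrite ltr0Sn.
have kk : (k.+1%:R : R) <= k.+2%:R by rewrite ler_nat.
set b := k.+1%:R `^ (- p); have b0 : 0 < b by rewrite powR_gt0.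
pose t : R := k.+1%:R / k.+2%:R.
have t0 : 0 < t by rewrite divr_gt0.
have t1 : t <= 1 by rewrite ler_pdivrMr// mul1r.
have -> : k.+2%:R `^ (- p) = t `^ p * b.
  rewrite /b powRN [in RHS]powRN /t powRM ?invr_ge0 ?(ltW k0) ?(ltW k20)//.
  rewrite mulrAC divff ?gt_eqF ?powR_gt0// mul1r -[k.+2%:R^-1]powR_inv1 ?(ltW k20)//.
  by rewrite -powRrM mulN1r powRN.
have tp : t <= t `^ p by apply: ger1_powR => //; rewrite t0.
have tp1 : t `^ p <= 1.
  by rewrite -(powRr0 t); apply: ger_powR; rewrite ?t0// ltW.
rewrite -[X in _ - X]mul1r -mulrBl normrM (gtr0_norm b0) mulfK ?gt_eqF//.
rewrite ler0_norm ?subr_le0// opprB.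
apply: (@le_trans _ _ (1 - t)); first lra.
have -> : 1 - t = k.+2%:R^-1.
  rewrite /t -[X in X - _](@divff _ k.+2%:R) ?gt_eqF// -mulrBl -(natr1 k.+1).
  by rewrite addrAC subrr add0r mul1r.
by rewrite lef_pV2 ?posrE.
Qed.

Lemma inv_ceil_le (R : realType) (N : nat) (a : R) : 0 < a ->
  N%:Z = Num.ceil a -> (0 < N)%N /\ (N%:R^-1 : R) <= a^-1.
Proof.
move=> a0 NE.
have aN : a <= N%:R.
  by have := ceil_ge a; rewrite -NE.
have N0 : (0 : R) < N%:R by exact: lt_le_trans aN.
by split; [rewrite -(ltr0n R) | rewrite lef_pV2 ?posrE].
Qed.

(** * Integrating pathwise bounds *)

Section LowerIntegral.
Local Open Scope ereal_scope.
Import HBNNSimple.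

(** Conclude by fixing one element at a time; when [s] is finite all quantities
are finite, so that subtraction is allowed. *)
Lemma ereal_supD_le (R : realType) (A B : set (\bar R)) (s : \bar R) :
  A 0 -> B 0 -> (forall a b, A a -> B b -> 0 <= a -> 0 <= b -> a + b <= s) ->
  ereal_sup A + ereal_sup B <= s.
Proof.
move=> A0 B0 h.
have s0 : 0 <= s by rewrite -[0]adde0; exact: h.
have [->|soo] := eqVneq s +oo; first by rewrite leey.
have sfin : s \is a fin_num by rewrite ge0_fin_numE// lt_neqAle soo leey.
have fin a : 0 <= a -> a <= s -> a \is a fin_num.
  by move=> a0 as_; rewrite ge0_fin_numE// (le_lt_trans as_)// lt_neqAle soo leey.
have supA0 : 0 <= ereal_sup A by exact: ereal_sup_ubound.
have supB b : B b -> 0 <= b -> ereal_sup A + b <= s.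
  move=> Bb b0.
  have bfin : b \is a fin_num by apply: fin => //; rewrite -[b]add0e; exact: h.
  rewrite -leeBrDr//; apply: ge_ereal_sup => a Aa.
  have [a0|/ltW a0] := leP 0 a; first by rewrite leeBrDr//; exact: h.
  apply: (le_trans a0); rewrite leeBrDr// add0e -[b]add0e; exact: h.
have Afin : ereal_sup A \is a fin_num.
  by apply: fin => //; have := supB _ B0 (lexx _); rewrite adde0.
rewrite addeC -leeBrDr//; apply: ge_ereal_sup => b Bb.
have [b0|/ltW b0] := leP 0 b; first by rewrite leeBrDr// addeC; exact: supB.
by apply: (le_trans b0); rewrite leeBrDr// add0e; have := supB _ B0 (lexx _); rewrite adde0.
Qed.

(** The integral of a nonnegative function is a supremum over the simple
functions below it, and simple functions below [f] and [g] add up to one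
below [f + g]. *)
Lemma integral_superadditive d (T : measurableType d) (R : realType)
    (mu : {measure set T -> \bar R}) (f g : T -> \bar R) :
  (forall x, 0 <= f x) -> (forall x, 0 <= g x) ->
  \int[mu]_x f x + \int[mu]_x g x <= \int[mu]_x (f x + g x).
Proof.
move=> f0 g0.
have fg0 x : 0 <= f x + g x by exact: adde_ge0.
rewrite !ge0_integralTE//; apply: ereal_supD_le.
- by exists nnsfun0 => //; exact: sintegral0.
- by exists nnsfun0 => //; exact: sintegral0.
move=> _ _ [h hf <-] [h' hg <-] _ _; rewrite -sintegralD//.
apply: ereal_sup_ubound; exists (add_nnsfun h h') => //= x.
by rewrite EFinD leeD.
Qed.

(** Monotonicity is a case of superadditivity, as [g = f + (g - f)]. *)
Lemma sum_integral_le d (T : measurableType d) (R : realType)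
    (mu : {measure set T -> \bar R}) (N : nat) (f : nat -> T -> R) (g : T -> R) :
  (forall k x, (0 <= f k x)%R) ->
  (forall x, (\sum_(0 <= k < N) f k x <= g x)%R) ->
  \sum_(0 <= k < N) \int[mu]_x (f k x)%:E <= \int[mu]_x (g x)%:E.
Proof.
move=> f0; elim: N g => [|N IH] g fg.
  by rewrite big_nil; apply: integral_ge0 => x _; have := fg x; rewrite big_nil lee_fin.
rewrite big_nat_recr//=.
have fg' x : (\sum_(0 <= k < N) f k x <= g x - f N x)%R.
  by have := fg x; rewrite big_nat_recr//= lerBrDr.
have gf0 x : 0 <= (g x - f N x)%:E.
  by rewrite lee_fin (le_trans _ (fg' x))// sumr_ge0.
apply: le_trans (leeD (IH _ fg') (lexx _)) _.
apply: le_trans (integral_superadditive _ gf0 _) _.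
  by move=> x; rewrite lee_fin.
by under eq_integral do rewrite -EFinD subrK.
Qed.

(** If every term exceeded [b / N], the sum would exceed [b]. *)
Lemma bigmin_average (R : realType) (N : nat) (e : nat -> \bar R) (b : R) :
  (0 < N)%N -> \sum_(0 <= k < N) e k <= b%:E ->
  \big[Order.min/+oo]_(0 <= k < N) e k <= (N%:R^-1 * b)%:E.
Proof.
move=> N0 eb; rewrite leNgt; apply/negP => lt.
have le k : (k < N)%N -> (N%:R^-1 * b)%:E < e k.
  move=> kN; apply: lt_le_trans lt _; rewrite big_mkord.
  exact: (@bigmin_le _ _ _ _ (Ordinal kN)).
move: eb; rewrite leNgt => /negP; apply.
have -> : b%:E = \sum_(0 <= k < N) (N%:R^-1 * b)%:E.
  rewrite sumEFin sumr_const_nat subn0 -(mulr_natl (N%:R^-1 * b)%R N) mulrA divff ?mul1r//.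
  by rewrite pnatr_eq0 -lt0n.
case: N N0 le {lt} => // N _ le.
rewrite !big_nat_recr//=.
apply: lee_ltD => //; last exact: le.
by rewrite sumEFin.
rewrite !big_nat; apply: lee_sum => k /andP[_ kN]; apply/ltW/le.
exact: ltnW.
Qed.

End LowerIntegral.

(** The whole space belongs to the sub-sigma-algebra, so [U] and its
conditional expectation have the same integral. *)
Lemma cond_expectation_bound d (Omega : measurableType d) (R : realType)
    (P : probability Omega R) (A : set (set Omega)) (U Y : Omega -> R) (c : R) :
  0 <= c -> A setT -> is_cond_expectation P A U Y -> {ae P, forall w, Y w <= c} ->
  (\int[P]_w (U w)%:E <= c%:E)%E.
Proof.
move=> c0 AT [_ Yint _ /(_ _ AT) <-] Yc.
have mY := measurable_int _ Yint.
rewrite integralE.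
apply: (@le_trans _ _ (\int[P]_w ((EFin \o Y)^\+ w))%E).
  rewrite leeBlDr ?leeDl ?integral_ge0//. exact: integrable_neg_fin_num.
have -> : c%:E = (\int[P]_w c%:E)%E by rewrite integral_cst//= probability_setT mule1.
apply: ae_ge0_le_integral => //.
- exact: measurable_funepos mY.
- case: Yc => N [mN N0 YN]; exists N; split => // w /= nYc; apply: YN => /= Yw.
  by apply: nYc => _; rewrite funeposE ge_max !lee_fin Yw c0.
Qed.

Lemma integral_affine_sum_le d (Omega : measurableType d) (R : realType)
    (P : probability Omega R) (W : nat -> Omega -> R) (b : nat -> R) (c e : R) T :
  0 <= c -> 0 <= e -> (forall k w, 0 <= W k w) ->
  (forall k, P.-integrable setT (EFin \o W k)) ->
  (forall k, \int[P]_w (W k w)%:E <= (b k)%:E)%E ->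
  (\int[P]_w (c + e * \sum_(0 <= k < T) W k w)%:E <=
    (c + e * \sum_(0 <= k < T) b k)%:E)%E.
Proof.
move=> c0 e0 W0 Wi Wb.
have mW k := measurable_int _ (Wi k).
under eq_integral do rewrite EFinD EFinM -sumEFin.
rewrite ge0_integralD//; last 2 first.
- by move=> w _; rewrite mule_ge0 ?lee_fin//; apply: sume_ge0 => k _; rewrite lee_fin.
- by apply: measurable_funeM; apply: emeasurable_sum.
rewrite integral_cst//= probability_setT mule1 EFinD leeD2l//.
rewrite ge0_integralZl_EFin//; last 2 first.
- by move=> w _; apply: sume_ge0 => k _; rewrite lee_fin.
- exact: emeasurable_sum.
rewrite EFinM lee_wpmul2l// -sumEFin ge0_integral_sum//; last by move=> k w _; rewrite lee_fin.
exact: lee_sum.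
Qed.

(** * The convergence rate *)

Theorem theorem2 (R : realType) (n m : nat)
    (X : set 'rV[R]_n)
    (X_nonempty : X !=set0) (X_closed : closed X)
    (X_convex : convex_set (X : set (convex_lmodType 'rV[R]_n)))
    (disp : measure_display) (Omega : measurableType disp)
    (P : probability Omega R)
    (xi : Omega -> 'rV[R]_m) (xi_random : random_vector xi)
    (G : 'rV[R]_n -> 'rV[R]_m -> 'rV[R]_n) (G_meas : jointly_measurable G)
    (F : 'rV[R]_n -> 'rV[R]_n)
    (F_well_defined : forall x, integrable_vector P (fun w => G x (xi w)))
    (F_def : forall x, F x = expectation_vector P (fun w => G x (xi w)))
    (Phi : 'rV[R]_n -> 'rV[R]_n) (L1 L2 mu : R)
    (F_monotone : monotone_map F) (F_lipschitz : elipschitz L1 F)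
    (mu_gt0 : 0 < mu) (Phi_monotone : strongly_monotone_map mu Phi)
    (Phi_lipschitz : elipschitz L2 Phi)
    (S_nonempty : inverse_vi_sol X F !=set0)
    (p q r delta : R)
    (p_gt0 : 0 < p) (p_le_q : p <= q) (q_le_r : q <= r) (r_lt1 : r < 1)
    (pr_lt1 : p + r < 1) (delta_gt0 : 0 < delta)
    (C1 C2 : R) (C1_def : C1 = (L1 + L2) ^+ 2 / mu)
    (C2_def : C2 = 1 / (8 * C1))
    (lam eta theta : nat -> R) (N : nat -> nat)
    (lam_def : forall k, lam k = k.+1%:R `^ (- p))
    (eta_def : forall k, eta k = C1 * k.+1%:R `^ q)
    (theta_def : forall k, theta k = C2 * k.+1%:R `^ (- r))
    (N_def : forall k, (N k)%:Z = Num.ceil (k.+1%:R `^ (1 + delta) : R))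
    (M : R) (M_gt0 : 0 < M)
    (M_bound : forall k l,
       enorm (regularized_sol X F Phi (lam k) - regularized_sol X F Phi (lam l))
       <= M * `|lam k - lam l| / lam l)
    (xis : nat -> nat -> Omega -> 'rV[R]_m)
    (xis_sample : forall k j, (1 <= j <= N k)%N ->
       random_vector (xis j k) /\ same_law P (xis j k) xi)
    (x0 : 'rV[R]_n) (x : nat -> Omega -> 'rV[R]_n)
    (x_def : x = rvc_ipg X G Phi xis lam eta theta N x0)
    (nu : R) (nu_gt0 : 0 < nu)
    (noise : stochastic_error_assumption P F G xis N x0 x nu) :
  exists C D : R, [/\ 0 < C, 0 < D &
    forall T : nat, (1 <= T)%N ->
      (\big[Order.min/+oo]_(0 <= k < T)
         'E_P[fun w => (enorm (residual X F (x k w) (eta k)) ^+ 2)%R]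
       <= (1 / T%:R *
           ((8 * p * C1 * M) ^+ 2 *
              (\sum_(0 <= k < T) k.+1%:R `^ (- 2 + r + q) *
                 (16 * C1 * k.+1%:R `^ (p + r) / mu
                  + k.+1%:R `^ (q - r) / 4 + 3))
            + 8 * C1 * nu ^+ 2 *
              (\sum_(0 <= k < T) k.+1%:R `^ (r + q - 1 - delta) *
                 (10 * C2 * k.+1%:R `^ (- 2 * r)
                  + 4 * k.+1%:R `^ (- r + p) / mu))
            + (\sum_(0 <= k < T) 8 * k.+1%:R `^ (- 2 * p) * C)
            + 64 * C1 ^+ 2 * D ^+ 2 * T%:R `^ (q + r)))%R%:E)%E].
Proof.
have C1ge0 : 0 <= C1 by rewrite C1_def divr_ge0 ?sqr_ge0// ltW.
have C2ge0 : 0 <= C2 by rewrite C2_def divr_ge0 ?mulr_ge0.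
have drift_ge0 T : 0 <= (8 * p * C1 * M) ^+ 2 *
    (\sum_(0 <= k < T) k.+1%:R `^ (- 2 + r + q) *
       (16 * C1 * k.+1%:R `^ (p + r) / mu + k.+1%:R `^ (q - r) / 4 + 3)).
  apply: mulr_ge0; first exact: sqr_ge0.
  apply: sumr_ge0 => k _; apply: mulr_ge0; first exact: powR_ge0.
  by rewrite !addr_ge0 ?divr_ge0 ?mulr_ge0 ?powR_ge0 ?(ltW mu_gt0).
have noise_ge0 T : 0 <= 8 * C1 * nu ^+ 2 *
    (\sum_(0 <= k < T) k.+1%:R `^ (r + q - 1 - delta) *
       (10 * C2 * k.+1%:R `^ (- 2 * r) + 4 * k.+1%:R `^ (- r + p) / mu)).
  apply: mulr_ge0; first exact: mulr_ge0 (mulr_ge0 (ler0n _ _) C1ge0) (sqr_ge0 _).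
  apply: sumr_ge0 => k _; apply: mulr_ge0; first exact: powR_ge0.
  by rewrite !addr_ge0 ?divr_ge0 ?mulr_ge0 ?powR_ge0 ?(ltW mu_gt0).
(* If C1 = 0 the space is trivial and every residual vanishes. *)
have [C1z|C1nz] := eqVneq C1 0.
  have LL : L1 + L2 = 0.
    have /eqP := C1_def; rewrite C1z eq_sym mulf_eq0 sqrf_eq0 invr_eq0.
    by rewrite (gt_eqF mu_gt0) orbF => /eqP.
  have z (u : 'rV[R]_n) : u = 0.
    have := strong_monotone_le_lipschitz u F_lipschitz Phi_monotone Phi_lipschitz.
    by rewrite LL mul0r pmulr_rle0// => /dot_eq0.
  exists 1, 1; split => // T T1.
  apply: (@le_trans _ _ 0%E).
    rewrite big_mkord; apply: le_trans (@bigmin_le _ _ _ _ (Ordinal T1) _) _.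
    rewrite expectation.unlock.
    under eq_integral do
      rewrite (z (residual _ _ _ _)) sqr_enorm -(scale0r 0) dotZl mul0r.
    by rewrite integral0.
  rewrite lee_fin mulr_ge0 ?divr_ge0// !addr_ge0//.
    by apply: sumr_ge0 => k _; rewrite !mulr_ge0 ?powR_ge0.
  apply: mulr_ge0 (powR_ge0 _ _); apply: mulr_ge0 (sqr_ge0 _).
  exact: mulr_ge0 (ler0n _ _) (sqr_ge0 _).
have C1_gt0 : 0 < C1 by rewrite lt_neqAle eq_sym C1nz.
have C2_gt0 : 0 < C2 by rewrite C2_def divr_gt0// mulr_gt0.
pose ep := 1 - (p + r).
have ep0 : 0 < ep by rewrite subr_gt0.
have r_gt0 : 0 < r by lra.
have k1 k : (1 : R) <= k.+1%:R by rewrite ler1n.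
have k0 k : (0 : R) < k.+1%:R by rewrite ltr0Sn.
have lam0 k : 0 < lam k by rewrite lam_def powR_gt0.
have lam1 k : lam k <= 1 by rewrite lam_def powR_le1// oppr_le0 ltW.
have eta0 k : 0 < eta k by rewrite eta_def mulr_gt0// powR_gt0.
have theta0 k : 0 < theta k by rewrite theta_def mulr_gt0// powR_gt0.
pose sigma k := lam k * mu.
have sigma0 k : 0 < sigma k by rewrite mulr_gt0.
pose A k := regularized F Phi (lam k).
pose ell := C1 * mu.
have AL k y z : dot (A k y - A k z) (A k y - A k z) <= ell * dot (y - z) (y - z).
  rewrite /ell C1_def divfK ?gt_eqF//; apply: elipschitz_dot.
  by apply: regularized_lipschitz; rewrite ?lam1 ?(ltW (lam0 k)).
have As k y z : sigma k * dot (y - z) (y - z) <= dot (A k y - A k z) (y - z).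
  by apply: regularized_monotone; rewrite ?(ltW (lam0 k)).
pose xs k := regularized_sol X F Phi (lam k).
have xsP k : inverse_vi_sol X (A k) (xs k).
  have := inverse_vi_sol_exists X_nonempty X_closed X_convex (sigma0 k) (AL k) (As k).
  exact: xgetPex.
have es k : ell <= eta k * sigma k.
  by rewrite /ell /sigma eta_def lam_def; exact: eta_sigma_ge.
have te k : theta k * eta k <= 4^-1.
  by rewrite theta_def eta_def; exact: step_eta_le.
have NP k : (0 < N k)%N /\ ((N k)%:R^-1 : R) <= k.+1%:R `^ (- (1 + delta)).
  by rewrite powRN; apply: inv_ceil_le => //; rewrite powR_gt0.
have drift k : dot (xs k - xs k.+1) (xs k - xs k.+1) <= M ^+ 2 * k.+1%:R `^ (- 2).
  have h : enorm (xs k.+1 - xs k) <= M * k.+1%:R^-1.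
    apply: le_trans (M_bound k.+1 k) _; rewrite -mulrA ler_wpM2l ?(ltW M_gt0)//.
    by rewrite !lam_def; apply: powR_drift_le => //; lra.
  rewrite dot_distC -sqr_enorm powR_invn ?(ltW (k0 k))// -exprVn -exprMn.
  by apply: lerXn2r => //; rewrite nnegrE ?enorm_ge0 ?mulr_ge0 ?invr_ge0 ?(ltW M_gt0).
(* Uniform bounds on the coefficients of the noise and of the drift. *)
pose beta := (1 + C2 * mu) * (2 * C2 ^+ 2 + 2 * C2 / mu).
pose gamma := (1 + 2 / (C2 * mu)) * M ^+ 2.
have C2mu : 0 < C2 * mu by rewrite mulr_gt0.
have beta0 : 0 <= beta.
  apply: mulr_ge0; first by rewrite addr_ge0 ?(ltW C2mu).
  apply: addr_ge0; first exact: mulr_ge0 (ler0n _ _) (sqr_ge0 _).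
  exact: divr_ge0 (mulr_ge0 (ler0n _ _) (ltW C2_gt0)) (ltW mu_gt0).
have gamma0 : 0 <= gamma.
  apply: mulr_ge0; last exact: sqr_ge0.
  by apply: addr_ge0 => //; exact: divr_ge0 (ler0n _ _) (ltW C2mu).
pose W k w := dot (averaged_noise F G xis N x k w) (averaged_noise F G xis N x k w).
pose V k w := dot (x k w - xs k) (x k w - xs k).
pose h k w := residual X (A k) (x k w) (eta k).
pose a k w := theta k / (2 * eta k) * dot (h k w) (h k w).
have W0 k w : 0 <= W k w by exact: dot_ge0.
have V0 k w : 0 <= V k w by exact: dot_ge0.
have a0 k w : 0 <= a k w.
  by apply: mulr_ge0; rewrite ?dot_ge0 ?divr_ge0 ?mulr_ge0 ?(ltW (theta0 k)) ?(ltW (eta0 k)).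
have descent k w : V k.+1 w + a k w <=
    V k w + (beta * W k w + gamma * k.+1%:R `^ (- (1 + ep))).
  have [Nk _] := NP k.
  rewrite {1}/V (rvc_ipgS F w x_def Nk).
  apply: le_trans (ipg_descent X_nonempty X_closed X_convex (x k w) (xs k.+1) _
    (AL k) (As k) (sigma0 k) (theta0 k) (eta0 k) (es k) (te k) (xsP k)) _.
  rewrite -addrA lerD2l; apply: lerD.
    rewrite ler_wpM2r ?dot_ge0// /sigma theta_def lam_def.
    exact: (noise_coef_le p_gt0 p_le_q q_le_r C1_gt0 mu_gt0 C2_def (k1 k)).
  have -> : gamma * k.+1%:R `^ (- (1 + ep)) =
      ((1 + 2 / (C2 * mu)) * k.+1%:R `^ (p + r)) * (M ^+ 2 * k.+1%:R `^ (- 2)).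
    have -> : - (1 + ep) = (p + r) + (- 2) by rewrite /ep; ring.
    by rewrite -powR_mulD// /gamma; ring.
  apply: ler_pM; rewrite ?dot_ge0 ?drift//.
    apply: addr_ge0 => //.
    exact: divr_ge0 (ler0n _ _) (ltW (mulr_gt0 (theta0 k) (sigma0 k))).
  by rewrite /sigma theta_def lam_def; exact: (@drift_coef_le _ p q r C2 mu).
pose S0 := dot (x0 - xs 0) (x0 - xs 0) + gamma * (1 + ep^-1).
have S00 : 0 <= S0.
  by rewrite addr_ge0 ?dot_ge0// mulr_ge0// addr_ge0// invr_ge0 ltW.
pose Q T w := S0 + beta * \sum_(0 <= j < T) W j w.
(* The initial distance is deterministic, so S0 is a constant. *)
have bound T w : V T w + \sum_(0 <= j < T) a j w <= Q T w.
  have := @telescope_le R (V^~ w) (a^~ w) _ (descent^~ w) T.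
  move=> /le_trans; apply; rewrite {1}/V x_def /= -/(xs 0) /Q /S0.
  rewrite big_split/= -!mulr_sumr -addrA lerD2l addrC lerD2r ler_wpM2l//.
  exact: sum_powR_le.
have QT k T w : (k <= T)%N -> Q k w <= Q T w.
  move=> kT; rewrite lerD2l ler_wpM2l// (big_cat_nat (leq0n k) kT)//= lerDl.
  exact: sumr_ge0.
have Vb k T w : (k < T)%N -> V k w <= Q T w.
  move=> kT; apply: le_trans (QT _ _ _ (ltnW kT)); apply: le_trans (bound k w).
  by rewrite lerDl; exact: sumr_ge0.
have ab T w : \sum_(0 <= j < T) a j w <= Q T w.
  by apply: le_trans (bound T w); rewrite lerDr.
pose K1 := 4 * dot (Phi (xs 0)) (Phi (xs 0)) + 4 * (L2 ^+ 2 * M ^+ 2).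
pose K2 := 2 * L2 ^+ 2.
have K10 : 0 <= K1.
  apply: addr_ge0; first exact: mulr_ge0 (ler0n _ _) (dot_ge0 _).
  exact: mulr_ge0 (ler0n _ _) (mulr_ge0 (sqr_ge0 _) (sqr_ge0 _)).
have K20 : 0 <= K2 by exact: mulr_ge0 (ler0n _ _) (sqr_ge0 _).
(* lam 0 = 1, so comparing with xs 0 bounds all the regularized solutions. *)
have xsb k : dot (xs k - xs 0) (xs k - xs 0) <= M ^+ 2.
  rewrite -sqr_enorm; apply: lerXn2r; rewrite ?nnegrE ?enorm_ge0 ?(ltW M_gt0)//.
  apply: le_trans (M_bound k 0) _.
  have -> : lam 0 = 1 by rewrite lam_def powR1.
  rewrite divr1 ler_piMr ?(ltW M_gt0)// ler0_norm ?subr_le0// opprB.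
  by rewrite lerBlDr lerDl (ltW (lam0 k)).
have Phib k w : dot (Phi (x k w)) (Phi (x k w)) <= K1 + K2 * V k w.
  have h1 := sqr_normD_le2 (Phi (x k w) - Phi (xs k)) (Phi (xs k)).
  have h2 := sqr_normD_le2 (Phi (xs k) - Phi (xs 0)) (Phi (xs 0)).
  rewrite !subrK in h1 h2.
  have h3 := elipschitz_dot (x k w) (xs k) Phi_lipschitz; rewrite -/(V k w) in h3.
  have h4 := elipschitz_dot (xs k) (xs 0) Phi_lipschitz.
  have h5 : L2 ^+ 2 * dot (xs k - xs 0) (xs k - xs 0) <= L2 ^+ 2 * M ^+ 2.
    by rewrite ler_wpM2l ?sqr_ge0.
  rewrite /K1 /K2; lra.
pose H k w := enorm (residual X F (x k w) (eta k)) ^+ 2.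
(* One factor 2 comes from residual_regularized, the rest from
   eta k / theta k <= (C1 / C2) T^(q + r). *)
pose E0 := 2 * (2 * (C1 / C2)).
have E00 : 0 < E0 by rewrite !mulr_gt0 ?invr_gt0.
have Hb k T w : (k < T)%N ->
    H k w <= E0 * T%:R `^ (q + r) * a k w + 2 * k.+1%:R `^ (- 2 * p) * (K1 + K2 * Q T w).
  move=> kT; rewrite /H sqr_enorm.
  apply: le_trans (residual_regularized X_nonempty X_closed X_convex F Phi (lam k) _ _) _.
  rewrite -/(A k) -/(h k w); apply: lerD.
    have -> : dot (h k w) (h k w) = 2 * eta k / theta k * a k w.
      by rewrite /a; field; rewrite ?(gt_eqF (eta0 k)) ?(gt_eqF (theta0 k)).
    rewrite eta_def theta_def (eta_div_step _ _ _ _ (k1 k)) mulrA ler_wpM2r//.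
    rewrite mulrA ler_wpM2l ?(ltW E00)//; apply: ge0_ler_powR; rewrite ?nnegrE ?ler_nat//.
    by rewrite addr_ge0// ltW//; lra.
  have -> : k.+1%:R `^ (- 2 * p) = lam k ^+ 2.
    by rewrite lam_def expr2 powR_mulD//; congr (_ `^ _); ring.
  rewrite -mulrA ler_pM2l// ler_wpM2l ?sqr_ge0//.
  by apply: le_trans (Phib k w) _; rewrite lerD2l ler_wpM2l// Vb.
pose Bd := S0 + beta * (nu ^+ 2 * (1 + delta^-1)).
have Bd0 : 0 <= Bd.
  apply: addr_ge0 => //; apply: mulr_ge0 => //.
  by apply: mulr_ge0; rewrite ?sqr_ge0// addr_ge0// invr_ge0 ltW.
have hT k : history xis N x0 k setT.
  by rewrite -setC0; apply: sigma_algebraC; exact: sigma_algebra0.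
have We k : (\int[P]_w (W k w)%:E <= (nu ^+ 2 * k.+1%:R `^ (- (1 + delta)))%:E)%E.
  have [_ [Y [Yc Yb]]] := noise k.
  have -> : (\int[P]_w (W k w)%:E =
     \int[P]_w (enorm (averaged_noise F G xis N x k w) ^+ 2)%:E)%E.
    by apply: eq_integral => w _; rewrite sqr_enorm.
  apply: (@le_trans _ _ (nu ^+ 2 / (N k)%:R)%:E).
    by apply: cond_expectation_bound Yc Yb => //; rewrite divr_ge0 ?sqr_ge0.
  by rewrite lee_fin ler_wpM2l ?sqr_ge0//; case: (NP k).
have Wi k : P.-integrable setT (EFin \o W k).
  have [_ [Y [[Ui _ _ _] _]]] := noise k.
  rewrite (_ : EFin \o W k = EFin \o (fun w => enorm (averaged_noise F G xis N x k w) ^+ 2))//.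
  by apply/funext => w /=; rewrite sqr_enorm.
(* 8 C must dominate 2 (K1 + K2 Bd), and 64 C1^2 D^2 must dominate
   E0 Bd = 32 C1^2 Bd; adding 1 makes both constants positive. *)
exists ((K1 + K2 * Bd) / 4 + 1), (Bd + 1); split.
- by rewrite ltr_wpDl// divr_ge0// addr_ge0// mulr_ge0.
- by rewrite ltr_wpDl.
move=> T T0.
pose sT := \sum_(0 <= k < T) 2 * k.+1%:R `^ (- 2 * p) : R.
have sT0 : 0 <= sT by apply: sumr_ge0 => k _; rewrite mulr_ge0 ?powR_ge0.
pose eT := E0 * T%:R `^ (q + r).
have eT0 : 0 <= eT by rewrite mulr_ge0 ?powR_ge0 ?(ltW E00).
have Hsum w : \sum_(0 <= k < T) H k w <= eT * Q T w + sT * (K1 + K2 * Q T w).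
  apply: (@le_trans _ _ (\sum_(0 <= k < T)
     (eT * a k w + 2 * k.+1%:R `^ (- 2 * p) * (K1 + K2 * Q T w)))).
    by rewrite !big_nat; apply: ler_sum => k /andP[_ kT]; exact: Hb.
  by rewrite big_split/= -mulr_sumr -mulr_suml lerD2r ler_wpM2l.
have EH : (\sum_(0 <= k < T) 'E_P[H k] <= (eT * Bd + sT * (K1 + K2 * Bd))%:E)%E.
  rewrite expectation.unlock; apply: le_trans (sum_integral_le _ _ Hsum) _.
    by move=> k w; rewrite /H sqr_enorm dot_ge0.
  rewrite /Q.
  have Qe w : eT * (S0 + beta * \sum_(0 <= j < T) W j w)
      + sT * (K1 + K2 * (S0 + beta * \sum_(0 <= j < T) W j w)) =
    (eT * S0 + sT * (K1 + K2 * S0)) + ((eT + sT * K2) * beta) * \sum_(0 <= j < T) W j w.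
    by ring.
  under eq_integral do rewrite Qe.
  apply: le_trans (integral_affine_sum_le _ _ _ W0 Wi We) _.
  - by rewrite addr_ge0// mulr_ge0// addr_ge0// mulr_ge0.
  - by rewrite mulr_ge0// addr_ge0// mulr_ge0.
  rewrite lee_fin -mulr_sumr.
  have := sum_powR_le T delta_gt0; set s := \sum_(_ <= _ < _) _ => sle.
  have : (eT + sT * K2) * beta * (nu ^+ 2 * s) <=
     (eT + sT * K2) * beta * (nu ^+ 2 * (1 + delta^-1)).
    apply: ler_wpM2l; last by rewrite ler_wpM2l ?sqr_ge0.
    by apply: mulr_ge0 => //; apply: addr_ge0 => //; exact: mulr_ge0.
  rewrite /Bd; lra.
apply: le_trans (bigmin_average T0 EH) _.
rewrite lee_fin div1r ler_wpM2l ?invr_ge0//.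
have := drift_ge0 T; have := noise_ge0 T.
set s1 := _ ^+ 2 * \sum_(0 <= k < T) _; set s2 := 8 * C1 * _ * \sum_(0 <= k < T) _.
set s3 := \sum_(0 <= k < T) _ => s2p s1p.
have s3E : s3 = 4 * sT * ((K1 + K2 * Bd) / 4 + 1).
  rewrite /s3 /sT mulr_sumr mulr_suml; apply: eq_bigr => k _; ring.
have E0E : E0 = 32 * C1 ^+ 2.
  by rewrite /E0 C2_def; field; rewrite gt_eqF.
have e3 : eT * Bd <= 64 * C1 ^+ 2 * (Bd + 1) ^+ 2 * T%:R `^ (q + r).
  rewrite /eT E0E mulrAC; apply: ler_wpM2r; first exact: powR_ge0.
  have -> : 64 * C1 ^+ 2 * (Bd + 1) ^+ 2 = 32 * C1 ^+ 2 * (2 * (Bd + 1) ^+ 2) by ring.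
  apply: ler_wpM2l; first by rewrite mulr_ge0 ?sqr_ge0.
  nra.
rewrite s3E; lra.
Qed.
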